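(* Let $A$ and $B$ be positive semidefinite matrices of the same size and let $C=(A^{1/2}BA^{1/2})^{1/2}$. Then $$\operatorname{tr}(e^{-A}e^{-B})\le \operatorname{tr}(e^{-A}+e^{-B})+\operatorname{tr}(e^{-2C}-2e^{-C}).$$ *)

(* Defs.v *)
(* complex matrices over R[i] for an arbitrary R : realType. *)
From HB Require Import structures.
From mathcomp Require Import all_boot all_order all_algebra.
From mathcomp Require Import sesquilinear spectral.
From mathcomp Require Import complex.
From mathcomp Require Import reals.
From mathcomp.analysis Require Import sequences exp.

Set Implicit Arguments.
Unset Strict Implicit.
Unset Printing Implicit Defensive.

Import Order.TTheory GRing.Theory Num.Theory.
Local Open Scope ring_scope.
Local Open Scope sesquilinear_scope.

(* Positive semidefinite complex matrix: Hermitian with nonnegative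
   quadratic form  v A v^* >= 0  for every (row) vector v. *)
Definition psdmx (R : realType) (n : nat) (A : 'M[R[i]]_n) : Prop :=
  A \is hermsymmx /\ forall v : 'rV[R[i]]_n, 0 <= (v *m A *m v ^t*) 0 0.

(* Functional calculus for Hermitian (more generally normal) matrices:
   with the unitary diagonalisation A = P^-1 diag(d) P provided by the
   library (spectralmx / spectral_diag), f(A) := P^-1 diag(f(d)) P,
   where f : R -> R is applied to the (real) eigenvalues. *)
Definition mxfun (R : realType) (f : R -> R) (n : nat) (A : 'M[R[i]]_n)
  : 'M[R[i]]_n :=
  invmx (spectralmx A) *m
    diag_mx (map_mx (fun z : R[i] => (f (complex.Re z))%:C%C) (spectral_diag A))
  *m spectralmx A.

(* matrix exponential and principal (PSD) square root *)
Definition mexp (R : realType) (n : nat) (A : 'M[R[i]]_n) := mxfun (@expR R) A.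
Definition msqrt (R : realType) (n : nat) (A : 'M[R[i]]_n) := mxfun (@Num.sqrt R) A.

(* Main.v *)
(** Write [f x = 1 - exp (- x)].  Expanding the products, the claim is
    [tr (f A f B) <= tr (f C)^2].  Let [q x = 2 x - x^2], so that
    [f (2 x) = q (f x)] and [q] is increasing on the unit interval.  The key
    point is that for [0 <= P, Q <= 1] the singular values satisfy
      [s_k (q(P)^(1/2) q(Q)^(1/2)) <= q (s_k (P^(1/2) Q^(1/2)))]  for every [k].
    Indeed, with [D'] the adjoint of [D], a singular value decomposition gives
    [P = D D'], [Q = E' E] with [E D = S] diagonal; then
    [q(P) = D (2 - D' D) D'] and [q(Q) = E' (2 - E E') E], the
    arithmetic-geometric mean inequality [2 s_k(X' Y) <= s_k(X X' + Y Y')]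
    bounds the new singular values by the eigenvalues of
    [S^(1/2) (4 - D' D - E E') S^(1/2) / 2], and [D' D + E E' >= 2 S] because
    [(D' - E) (D' - E)' >= 0].
    Start from [P = f (A / 2^m) <= A / 2^m] and [Q = f (B / 2^m) <= B / 2^m],
    whose singular values are at most [c_k / 2^m], [c_k] the eigenvalues of [C];
    applying the key point [m] times gives
      [tr (f A f B) <= \sum_k (1 - (1 - c_k / 2^m)^(2^m))^2],
    and [m] tends to infinity. *)
Require Import Defs.
From HB Require Import structures.
From mathcomp Require Import all_boot all_order all_algebra.
From mathcomp Require Import sesquilinear spectral.
From mathcomp Require Import complex.
From mathcomp Require Import reals.
From mathcomp.analysis Require Import sequences exp.
From mathcomp Require Import ring lra.
Import Order.TTheory GRing.Theory Num.Theory.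
Local Open Scope ring_scope.
Local Open Scope sesquilinear_scope.
Set Implicit Arguments.
Unset Strict Implicit.
Unset Printing Implicit Defensive.

(** * Positive forms and the singular value decomposition *)

Section Adjoint.
Variable C : numClosedFieldType.

Lemma adjmxM m n p (A : 'M[C]_(m, n)) (B : 'M_(n, p)) :
  (A *m B)^t* = B^t* *m A^t*.
Proof. by rewrite trmx_mul map_mxM. Qed.

Lemma adjmxD m n (A B : 'M[C]_(m, n)) : (A + B)^t* = A^t* + B^t*.
Proof. by rewrite linearD /= map_mxD. Qed.

Lemma adjmxB m n (A B : 'M[C]_(m, n)) : (A - B)^t* = A^t* - B^t*.
Proof. by rewrite linearB /= map_mxB. Qed.

Lemma adjmx1 n : (1%:M : 'M[C]_n)^t* = 1%:M.
Proof. by rewrite trmx1 map_mx1. Qed.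

Lemma unitarymx_tmul n (U : 'M[C]_n) : U \is unitarymx -> U^t* *m U = 1%:M.
Proof. by move=> /unitarymxP /mulmx1C. Qed.

Definition psdform n (X : 'M[C]_n) :=
  forall v : 'rV[C]_n, 0 <= (v *m X *m v^t*) 0 0.

Lemma mulmx_adj_ge0 n (v : 'rV[C]_n) : 0 <= (v *m v^t*) 0 0.
Proof.
by rewrite mxE sumr_ge0 // => i _; rewrite !mxE mul_conjC_ge0.
Qed.

Lemma mulmx_adj_gt0 n (v : 'rV[C]_n) : v != 0 -> 0 < (v *m v^t*) 0 0.
Proof. by move=> v0; rewrite -dotmxE dotmx_is_dotmx. Qed.

Lemma psdformD n (X Y : 'M[C]_n) :
  psdform X -> psdform Y -> psdform (X + Y).
Proof. by move=> hX hY v; rewrite mulmxDr mulmxDl mxE addr_ge0. Qed.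

Lemma psdform_conj m n (G : 'M[C]_(m, n)) (X : 'M[C]_n) :
  psdform X -> psdform (G *m X *m G^t*).
Proof. by move=> hX v; move: (hX (v *m G)); rewrite adjmxM !mulmxA. Qed.

Lemma psdform1 n : psdform (1%:M : 'M[C]_n).
Proof. by move=> v; rewrite mulmx1 mulmx_adj_ge0. Qed.

Lemma psdform_gram m n (G : 'M[C]_(m, n)) : psdform (G *m G^t*).
Proof. by have := psdform_conj G (@psdform1 n); rewrite mulmx1. Qed.

(** Induction on the number of indices outside [S]: the rows there are ignored and replaced, one at
    a time, by a unit vector orthogonal to the rows in [S]. *)
Lemma orthonormal_rows_extend n (S : {set 'I_n}) (Y : 'M[C]_n) :
    {in S &, forall i j, (Y *m Y^t*) i j = (i == j)%:R} ->
  exists2 W, W \is unitarymx & {in S, forall i, row i W = row i Y}.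
Proof.
have [k leSk] := ubnP #|~: S|; elim: k => // k IHk in S Y leSk *.
move=> orthoY; have [SE|/subsetPn[i0 _ i0S]] := boolP ([set: 'I_n] \subset S).
  exists Y => //; apply/unitarymxP/matrixP => i j; rewrite orthoY ?mxE //;
  by rewrite (subsetP SE) ?inE.
(* Row [i0] of [Y0] is zero, so [Y0^t*] is singular; a left null vector of it is orthogonal to every
   row of [Y] indexed by [S]. *)
pose Y0 : 'M[C]_n := \matrix_(i, j) (if i \in S then Y i j else 0).
have /eqP/det0P[v v0 vY0] : \det (Y0^t*) = 0.
  rewrite det_map_mx det_tr (expand_det_row _ i0) big1 ?rmorph0 // => j _.
  by rewrite mxE (negPf i0S) mul0r.
have ortho_v i : i \in S -> (v *m Y^t*) 0 i = 0.
  move=> iS; have /matrixP/(_ 0 i) := vY0; rewrite [RHS]mxE => <-.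
  by rewrite !mxE; apply: eq_bigr => j _; rewrite !mxE iS.
pose c := sqrtC ((v *m v^t*) 0 0).
have c_gt0 : 0 < c by rewrite sqrtC_gt0 mulmx_adj_gt0.
pose w := c^-1 *: v.
have cR : c^* = c by apply/CrealP/ger0_real/ltW.
have ww : (w *m w^t*) 0 0 = 1.
  rewrite /w -scalemxAl linearZ /= map_mxZ -scalemxAr /= 2!mxE.
  rewrite fmorphV -[X in _ * (X^-1 * _)]/(c^*) cR.
  rewrite mulrA -expr2 -[X in _ * X](sqrtCK) -/c -exprMn mulVf ?expr1n //.
  by rewrite gt_eqF.
have wY i : i \in S -> (w *m Y^t*) 0 i = 0.
  by move=> iS; rewrite /w -scalemxAl mxE ortho_v // mulr0.
pose Y1 : 'M[C]_n := \matrix_(i, j) (if i == i0 then w 0 j else Y i j).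
have Y1E i j : (Y1 *m Y1^t*) i j =
   if i == i0 then if j == i0 then (w *m w^t*) 0 0 else (w *m Y^t*) 0 j
   else if j == i0 then (Y *m w^t*) i 0 else (Y *m Y^t*) i j.
  by case: eqP => ii0; case: eqP => ji0; rewrite !mxE; apply: eq_bigr => l _;
     rewrite !mxE ?ii0 ?ji0 ?eqxx //; do ?[case: eqP => //].
have Yw i : i \in S -> (Y *m w^t*) i 0 = 0.
  move=> iS; have := congr1 Num.conj (wY _ iS); rewrite rmorph0 => <-.
  have -> : Y *m w^t* = (w *m Y^t*)^t* by rewrite adjmxM trmxCK.
  by rewrite !mxE.
have [||W Wu WE] := IHk (i0 |: S) Y1.
- rewrite (cardsD1 i0) inE i0S /= add1n ltnS in leSk.
  by apply: leq_ltn_trans leSk; rewrite subset_leq_card // setCU setIC setDE.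
- move=> i j; rewrite !inE Y1E => iS jS.
  case: eqP iS => [-> _|ni /= iS]; case: eqP jS => [-> _|nj /= jS];
    rewrite ?eqxx //.
  + by rewrite wY //; case: eqP => // e; case: nj.
  + by rewrite Yw //; case: eqP => // e; case: ni.
  + exact: orthoY.
exists W => // i iS; rewrite WE ?inE ?iS ?orbT //.
by apply/rowP => j; rewrite !mxE; case: eqP iS i0S => [->|//] ->.
Qed.

End Adjoint.

(** * Real diagonal matrices, spectral and singular value decompositions *)

Section RealDiagonal.
Variables (R : realType) (n : nat).
Local Notation C := R[i].

Definition dgmx (x : 'I_n -> R) : 'M[C]_n := diag_mx (\row_i (x i)%:C%C).

Lemma dgmxE x i j : dgmx x i j = (x i)%:C%C *+ (i == j).
Proof. by rewrite !mxE. Qed.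

Lemma eq_dgmx {x y} : x =1 y -> dgmx x = dgmx y.
Proof. by move=> e; apply/matrixP => i j; rewrite !dgmxE e. Qed.

Lemma dgmxM x y : dgmx x *m dgmx y = dgmx (fun i => x i * y i).
Proof.
rewrite /dgmx mulmx_diag; congr diag_mx; apply/rowP => i.
by rewrite !mxE rmorphM.
Qed.

Lemma dgmxD x y : dgmx x + dgmx y = dgmx (fun i => x i + y i).
Proof.
by rewrite /dgmx -linearD; congr diag_mx; apply/rowP => i; rewrite !mxE rmorphD.
Qed.

Lemma dgmxB x y : dgmx x - dgmx y = dgmx (fun i => x i - y i).
Proof.
by rewrite /dgmx -linearB; congr diag_mx; apply/rowP => i; rewrite !mxE rmorphB.
Qed.

Lemma dgmx1 : dgmx (fun=> 1) = 1%:M.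
Proof. by apply/matrixP => i j; rewrite dgmxE mxE rmorph1. Qed.

Lemma adj_dgmx x : (dgmx x)^t* = dgmx x.
Proof.
apply/matrixP => i j; rewrite !mxE eq_sym rmorphMn; case: eqP => [->|//].
by rewrite !mulr1n; apply/CrealP; rewrite complex_real.
Qed.

Lemma row_dgmx_mul x (X : 'M[C]_n) i :
  row i (dgmx x *m X) = (x i)%:C%C *: row i X.
Proof. by apply/rowP => j; rewrite mxE mul_diag_mx !mxE. Qed.

Lemma mxtrace_dgmx x : \tr (dgmx x) = (\sum_i x i)%:C%C.
Proof.
by rewrite /dgmx mxtrace_diag rmorph_sum; apply: eq_bigr => i _; rewrite mxE.
Qed.

Lemma dgmx_form x (v : 'rV[C]_n) :
  (v *m dgmx x *m v^t*) 0 0 = \sum_i (x i)%:C%C * (v 0 i * (v 0 i)^*).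
Proof.
rewrite mxE; apply: eq_bigr => i _; rewrite mul_mx_diag !mxE; ring.
Qed.

Lemma psdform_dgmx x : (forall i, 0 <= x i) -> psdform (dgmx x).
Proof.
move=> x0 v; rewrite dgmx_form sumr_ge0 // => i _.
by rewrite mulr_ge0 ?mul_conjC_ge0 // ler0c.
Qed.

Lemma hermitian_spectral (X : 'M[C]_n) : X^t* = X ->
  exists (U : 'M[C]_n) (x : 'I_n -> R),
    U \is unitarymx /\ X = U^t* *m dgmx x *m U.
Proof.
move=> hX; have XH : X \is hermsymmx.
  by apply/is_hermitianmxP; rewrite expr0 scale1r hX.
have /orthomx_spectralP {1}-> := hermitian_normalmx XH.
rewrite invmx_unitary ?spectral_unitarymx //.
exists (spectralmx X), (fun i => complex.Re (spectral_diag X 0 i)); split.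
  exact: spectral_unitarymx.
congr (_ *m _ *m _); rewrite /dgmx; congr diag_mx; apply/rowP => i; rewrite mxE.
by rewrite RRe_real // (mxOverP (hermitian_spectral_diag_real XH)).
Qed.

Lemma psdform_spectral (X : 'M[C]_n) : X^t* = X -> psdform X ->
  exists (U : 'M[C]_n) (x : 'I_n -> R), [/\ U \is unitarymx, forall i, 0 <= x i &
    X = U^t* *m dgmx x *m U].
Proof.
move=> hX pX; have [U [x [Uu XE]]] := hermitian_spectral hX.
exists U, x; split => // i.
have := psdform_conj U pX (delta_mx 0 i).
rewrite XE !mulmxA !mulmxtVK //.
rewrite dgmx_form (bigD1 i) //= big1 ?addr0.
  by rewrite mxE !eqxx conjC1 !mulr1 ler0c.
by move=> j ji; rewrite mxE (negPf ji) andbF mul0r mulr0.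
Qed.

Lemma psdform_factor (X : 'M[C]_n) : X^t* = X -> psdform X ->
  exists G : 'M[C]_n, X = G *m G^t*.
Proof.
move=> hX pX; have [U [x [Uu x0 ->]]] := psdform_spectral hX pX.
exists (U^t* *m dgmx (fun i => Num.sqrt (x i))).
rewrite adjmxM adj_dgmx trmxCK mulmxA -[_ *m _ *m dgmx _]mulmxA dgmxM.
by congr (_ *m _ *m _); apply: eq_dgmx => i; rewrite -expr2 sqr_sqrtr.
Qed.

(** The rows of [U *m T] are pairwise orthogonal with squared norms [x i]; the nonzero ones are
    normalised and completed to the unitary matrix [W]. *)
Lemma svd (T : 'M[C]_n) : exists (V W : 'M[C]_n) (s : 'I_n -> R),
  [/\ V \is unitarymx, W \is unitarymx, forall i, 0 <= s i &
      T = V *m dgmx s *m W].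
Proof.
have [||U [x [Uu x0 TT]]] := @psdform_spectral (T *m T^t*).
- by rewrite adjmxM trmxCK.
- exact: psdform_gram.
pose s i := Num.sqrt (x i); pose Y := U *m T.
have YY : Y *m Y^t* = dgmx x.
  rewrite /Y adjmxM mulmxA -[U *m T *m _]mulmxA TT !mulmxA mulmxtVK //.
  by rewrite (unitarymxP _) // mul1mx.
pose S := [set i | x i != 0].
pose Z := dgmx (fun i => (s i)^-1) *m Y.
have [|W Wu WE] := @orthonormal_rows_extend _ n S Z.
  move=> i j; rewrite !inE => xi xj.
  rewrite /Z adjmxM adj_dgmx mulmxA -[_ *m Y *m _]mulmxA YY !dgmxM dgmxE.
  have si : s i != 0 by rewrite sqrtr_eq0 -ltNge lt_def xi x0.
  have -> : x i = s i * s i by rewrite -expr2 sqr_sqrtr.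
  by rewrite mulKf // divff // rmorph1.
exists (U^t*), W, s; split; rewrite ?trmxC_unitary //.
  by move=> i; apply: sqrtr_ge0.
suff YE : Y = dgmx s *m W.
  by rewrite -mulmxA -YE /Y mulmxA unitarymx_tmul // mul1mx.
apply/row_matrixP => i; rewrite row_dgmx_mul.
(* Nothing is known about row [i] of [W] when [x i = 0], but then row [i] of [Y] has squared norm
   zero and vanishes. *)
have [xi|xi] := eqVneq (x i) 0.
  rewrite /s xi sqrtr0 rmorph0 scale0r.
  apply/eqP; apply: contraT => /mulmx_adj_gt0.
  have -> : (row i Y *m (row i Y)^t*) 0 0 = (Y *m Y^t*) i i.
    by rewrite !mxE; apply: eq_bigr => k _; rewrite !mxE.
  by rewrite YY dgmxE xi mul0rn ltxx.
rewrite WE ?inE // row_dgmx_mul scalerA -rmorphM divff ?scale1r //.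
by rewrite sqrtr_eq0 -ltNge lt_def xi x0.
Qed.

End RealDiagonal.

(** * Eigenvalue domination and the arithmetic-geometric mean inequality *)

Section Dominance.
Variable R : realType.

(* Equivalently, after sorting both families in decreasing order, the k-th
   entry of x is at most the k-th entry of y, for every k. *)
Definition dominated (I : finType) (x y : I -> R) :=
  forall t : R,
    (#|[set i | (t <= x i)%R]| <= #|[set i | (t <= y i)%R]|)%N.

Lemma dominated_trans (I : finType) (y x z : I -> R) :
  dominated x y -> dominated y z -> dominated x z.
Proof. by move=> xy yz t; apply: leq_trans (yz t). Qed.

Lemma eq_dominated (I : finType) (x x' y y' : I -> R) :
  x =1 x' -> y =1 y' -> dominated x y -> dominated x' y'.
Proof.
move=> ex ey xy t; have := xy t; congr (_ <= _)%N; apply: eq_card => i;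
by rewrite !inE ?ex ?ey.
Qed.

(** Monotonicity of [h] is asked only between values [x i <= y j], which suits functions increasing
    on part of the line. If [x m] is the least [x i] with [t <= h (x i)], domination at level [x m]
    gives the claim at level [t]. *)
Lemma dominated_map (I : finType) (h : R -> R) (x y : I -> R) :
    (forall i j, x i <= y j -> h (x i) <= h (y j)) ->
  dominated x y -> dominated (h \o x) (h \o y).
Proof.
move=> hh xy t.
have [i0 ti0|none] := pickP [pred i | t <= h (x i)]; last first.
  by rewrite (eq_card0 (A := [set i | _])) // => i; rewrite inE -[RHS](none i).
pose m := [arg min_(i < i0 | t <= h (x i)) x i]%O.
have [tm min_m] : t <= h (x m) /\ forall i, t <= h (x i) -> x m <= x i.
  by rewrite /m; case: Order.TotalTheory.arg_minP => // i ti mi.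
apply: leq_trans (leq_trans (xy (x m)) _); apply/subset_leq_card/subsetP => i;
  rewrite !inE.
- exact: min_m.
- by move=> /hh; apply: le_trans.
Qed.

Lemma dominated_sum (I : finType) (x y : I -> R) :
  (forall i, 0 <= y i) -> dominated x y -> \sum_i x i <= \sum_i y i.
Proof.
have sumT (z : I -> R) : \sum_i z i = \sum_(i in [set: I]) z i.
  by apply: eq_bigl => i; rewrite inE.
(* Remove an index maximising x and one whose y-value is at least as large;
   the remaining families are still dominated. *)
move=> y0 xy; rewrite !sumT {sumT}.
have {xy}: forall t, (#|[set i in [set: I] | (t <= x i)%R]| <=
    #|[set i in [set: I] | (t <= y i)%R]|)%N.
  by move=> t; have := xy t; congr (_ <= _)%N; apply: eq_card => i; rewrite !inE.
(* The two index sets are generalised separately, [T] for [x] and [S] for [y], because different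
   indices are removed from them. *)
move: [set: I] {1 3}[set: I] => S T.
have [k] := ubnP #|T|; elim: k => // k IHk in S T *; move=> leTk xy.
have [->|/set0Pn[i0 i0T]] := eqVneq T set0.
  by rewrite big_set0 sumr_ge0.
pose i := [arg max_(i > i0 in T) x i]%O.
have [iT xi] : i \in T /\ forall l, l \in T -> x l <= x i.
  by rewrite /i; case: Order.TotalTheory.arg_maxP => // l ti mi.
have [j jS xij] : exists2 j, j \in S & x i <= y j.
  have : (0 < #|[set j in S | (x i <= y j)%R]|)%N.
    by apply: leq_trans (xy (x i)); apply/card_gt0P; exists i; rewrite inE iT lexx.
  by move=> /card_gt0P[j]; rewrite inE => /andP[]; exists j.
rewrite (big_setD1 i iT) /= (big_setD1 j jS) /= lerD // IHk //.
  by rewrite (cardsD1 i) iT ltnS in leTk.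
move=> t; have := xy t; rewrite !setIdE.
rewrite (cardsD1 i) (cardsD1 j (S :&: _)) !inE iT jS /= => le_t.
(* If [t <= x i], both removed indices were counted and both counts drop by one; otherwise [x i] is
   maximal on [T] and the left count is zero. *)
have [txi|xit] := leP t (x i).
  rewrite txi (le_trans txi xij) !add1n ltnS in le_t.
  by rewrite ![(_ :\ _) :&: _]setIC !setIDA ![[set _ | _] :&: _]setIC.
rewrite (eq_card0 (A := _ :&: _)) // => l; rewrite !inE; apply/negP.
by move=> /andP[/andP[_ lT]]; rewrite leNgt (le_lt_trans (xi _ lT)).
Qed.

Variable n : nat.
Local Notation C := R[i].
Implicit Types (x y s c w : 'I_n -> R) (U K G H D E : 'M[C]_n).

(** Weyl monotonicity by a dimension count. If more [x i] than [y j] reached [t], some nonzero [v]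
    supported on [I] would have [z = v *m U] vanishing on [J]; the form of [dgmx x] at [v] would be
    at least [t] times the squared norm, that of [dgmx y] at [z] strictly less. *)
Lemma weyl_dominated U x y : U \is unitarymx ->
  psdform (U *m dgmx y *m U^t* - dgmx x) -> dominated x y.
Proof.
move=> Uu UyUx t; rewrite leqNgt; apply/negP.
set I := [set i | t <= x i]; set J := [set j | t <= y j] => ltJI.
(* [N] is the block of [U] with rows in [I] and columns in [J]; having more rows than columns, it
   has a nonzero left kernel vector. *)
pose N := colsub (fun b : 'I_#|J| => enum_val b)
            (rowsub (fun a : 'I_#|I| => enum_val a) U).
have : kermx N != 0.
  rewrite kermx_eq0 -row_leq_rank -ltnNge.
  exact: leq_ltn_trans (rank_leq_col _) ltJI.
move=> /rowV0Pn[u /sub_kermxP uN u0].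
pose v := u *m rowsub (fun a : 'I_#|I| => enum_val a) 1%:M.
pose z := v *m U.
have zJ j : j \in J -> z 0 j = 0.
  move=> jJ; have /matrixP/(_ 0 (enum_rank_in jJ j)) := uN.
  rewrite /N mulmx_colsub /z /v -mulmxA mul_rowsub_mx mul1mx.
  by rewrite [colsub _ _ _ _]mxE [X in _ = X -> _]mxE enum_rankK_in.
have vI i : i \notin I -> v 0 i = 0.
  move=> iI; rewrite mxE big1 // => a _; rewrite !mxE.
  by case: eqP => [e|]; rewrite ?mulr0 //; rewrite -e enum_valP in iI.
have v0 : v != 0.
  apply: contra u0 => /eqP vE; apply/eqP/rowP => a.
  have /rowP/(_ (enum_val a)) := vE; rewrite !mxE (bigD1 a) //= big1.
    by rewrite !mxE eqxx mulr1 addr0 => ->.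
  by move=> b ba; rewrite !mxE (inj_eq enum_val_inj) (negPf ba) mulr0.
clearbody v; have zv : z *m U^t* = v by rewrite /z mulmxtVK.
have nvz : \sum_i z 0 i * (z 0 i)^* = \sum_i v 0 i * (v 0 i)^*.
  have <- : (z *m z^t*) 0 0 = \sum_i z 0 i * (z 0 i)^*.
    by rewrite mxE; apply: eq_bigr => i _; rewrite !mxE.
  have <- : (v *m v^t*) 0 0 = \sum_i v 0 i * (v 0 i)^*.
    by rewrite mxE; apply: eq_bigr => i _; rewrite !mxE.
  by rewrite /z adjmxM mulmxA mulmxtVK.
have zge i : 0 <= (t - y i)%:C%C * (z 0 i * (z 0 i)^*).
  have [iJ|iJ] := boolP (i \in J); first by rewrite zJ // mul0r mulr0.
  rewrite mulr_ge0 ?mul_conjC_ge0 // ler0c subr_ge0 ltW //.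
  by rewrite inE -ltNge in iJ.
have : \sum_i (t - y i)%:C%C * (z 0 i * (z 0 i)^*) <= 0.
  apply: (@le_trans _ _ (\sum_i (t - x i)%:C%C * (v 0 i * (v 0 i)^*))).
    rewrite (eq_bigr (fun i => t%:C%C * (z 0 i * (z 0 i)^*) -
       (y i)%:C%C * (z 0 i * (z 0 i)^*))); last first.
      by move=> i _; rewrite rmorphB mulrBl.
    rewrite [leRHS](eq_bigr (fun i => t%:C%C * (v 0 i * (v 0 i)^*) -
       (x i)%:C%C * (v 0 i * (v 0 i)^*))); last first.
      by move=> i _; rewrite rmorphB mulrBl.
    rewrite !sumrB -!mulr_sumr nvz lerD2l lerN2 -!dgmx_form -subr_ge0.
    have := UyUx v; rewrite mulmxBr mulmxBl mxE [X in _ + X]mxE.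
    by rewrite /z adjmxM !mulmxA.
  rewrite -oppr_ge0 -sumrN sumr_ge0 // => i _.
  have [iI|iI] := boolP (i \in I); last by rewrite vI // mul0r mulr0 oppr0.
  rewrite -mulNr -rmorphN mulr_ge0 ?mul_conjC_ge0 // ler0c opprB subr_ge0.
  by rewrite inE in iI.
move=> sum_le; have {}sum_le : \sum_i (t - y i)%:C%C * (z 0 i * (z 0 i)^*) = 0.
  by apply: le_anti; rewrite sum_le sumr_ge0.
case/negP: v0; rewrite -zv; suff -> : z = 0 by rewrite mul0mx.
apply/rowP => j; rewrite [RHS]mxE.
have [jJ|jJ] := boolP (j \in J); first exact: zJ.
have /(_ j isT)/eqP := psumr_eq0P (fun i _ => zge i) sum_le.
rewrite mulf_eq0 mul_conjC_eq0 => /orP[|/eqP//].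
rewrite inE -ltNge in jJ.
by rewrite -(rmorph0 (real_complex R)) (inj_eq (@complexI R)) subr_eq0 gt_eqF.
Qed.

(** By the singular value decomposition both Gram matrices of [K] have the eigenvalues [k i * k i],
    which are inserted between [x] and [y] by two uses of Weyl monotonicity. *)
Lemma gram_dominated K x y :
  psdform (K^t* *m K - dgmx x) -> psdform (dgmx y - K *m K^t*) ->
  dominated x y.
Proof.
have [V [W [k [Vu Wu k0 ->]]]] := svd K.
rewrite !adjmxM !adj_dgmx !mulmxA -[W^t* *m _ *m _ *m V]mulmxA.
rewrite (unitarymx_tmul Vu) mulmx1 (mulmxtVK _ Wu).
have kk (Z : 'M[C]_n) :
    Z *m dgmx k *m dgmx k = Z *m dgmx (fun i => k i * k i).
  by rewrite -mulmxA dgmxM.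
rewrite !kk {kk}.
move=> hx hy; apply: (@dominated_trans _ (fun i => k i * k i)).
  have hx' : psdform (W^t* *m dgmx (fun i => k i * k i) *m (W^t*)^t* - dgmx x).
    rewrite (trmxCK W); exact: hx.
  by apply: weyl_dominated hx'; rewrite trmxC_unitary.
have hy' : psdform (V^t* *m dgmx y *m (V^t*)^t* - dgmx (fun i => k i * k i)).
  have := psdform_conj (V^t*) hy; rewrite (trmxCK V) mulmxBr mulmxBl !mulmxA.
  by rewrite (unitarymx_tmul Vu) mul1mx (mulmxKtV _ Vu).
by apply: weyl_dominated hy'; rewrite trmxC_unitary.
Qed.

(** The arithmetic-geometric mean inequality for singular values, applied to [A = r H'] and
    [B = r G] with [r] the square root of [c]: then [A' B = s], and [A A' + B B'] is at most
    [r w r], the diagonal matrix of the [c i * w i]. *)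
Lemma amgm_dominated s c w G H : (forall i, 0 <= c i) ->
    dgmx s = H *m dgmx c *m G ->
    psdform (dgmx w - (H^t* *m H + G *m G^t*)) ->
  dominated s (fun i => c i * w i / 2).
Proof.
move=> c0 sE hw; pose r i := Num.sqrt (c i).
have rr : dgmx r *m dgmx r = dgmx c.
  by rewrite dgmxM; apply: eq_dgmx => i; rewrite -expr2 sqr_sqrtr.
pose A := dgmx r *m H^t*; pose B := dgmx r *m G.
have AB : A^t* *m B = dgmx s.
  by rewrite /A /B adjmxM adj_dgmx trmxCK mulmxA -[H *m _ *m _]mulmxA rr.
have BA : B^t* *m A = dgmx s.
  by rewrite -[LHS]trmxCK adjmxM trmxCK AB adj_dgmx.
(* With K = A + B and ' the adjoint: K' K - 4 s = (A - B)' (A - B) and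
   2 (A A' + B B') - K K' = (A - B) (A - B)'. *)
have four : dominated (fun i => 4 * s i) (fun i => 2 * c i * w i).
  apply: (gram_dominated (K := A + B)).
    have -> : (A + B)^t* *m (A + B) - dgmx (fun i => 4 * s i) =
        (A - B)^t* *m (A - B)^t*^t*.
      rewrite trmxCK adjmxB adjmxD.
      rewrite !(mulmxDl, mulmxDr, mulmxN, mulNmx, opprK) AB BA.
      have -> : dgmx (fun i => 4 * s i) = dgmx s + dgmx s + dgmx s + dgmx s.
        by rewrite !dgmxD; apply: eq_dgmx => i; ring.
      move: (A^t* *m A) (B^t* *m B) (dgmx s) => X Y L.
      by apply/matrixP => i j; rewrite !mxE; ring.
    exact: psdform_gram.
  have -> : dgmx (fun i => 2 * c i * w i) - (A + B) *m (A + B)^t* =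
      dgmx r *m (dgmx w - (H^t* *m H + G *m G^t*)) *m (dgmx r)^t* +
      dgmx r *m (dgmx w - (H^t* *m H + G *m G^t*)) *m (dgmx r)^t* +
      (A - B) *m (A - B)^t*.
    rewrite adj_dgmx adjmxB adjmxD !(mulmxDl, mulmxDr, mulmxN, mulNmx, opprK).
    have -> : dgmx r *m (H^t* *m H) *m dgmx r = A *m A^t*.
      by rewrite /A adjmxM trmxCK adj_dgmx !mulmxA.
    have -> : dgmx r *m (G *m G^t*) *m dgmx r = B *m B^t*.
      by rewrite /B adjmxM adj_dgmx !mulmxA.
    have -> : dgmx r *m dgmx w *m dgmx r = dgmx (fun i => c i * w i).
      by rewrite !dgmxM; apply: eq_dgmx => i; rewrite mulrAC -expr2 sqr_sqrtr.
    have -> : dgmx (fun i => 2 * c i * w i) =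
       dgmx (fun i => c i * w i) + dgmx (fun i => c i * w i).
      by rewrite dgmxD; apply: eq_dgmx => i; ring.
    move: (A *m A^t*) (B *m B^t*) (A *m B^t*) (B *m A^t*) => X Y Z T.
    by move: (dgmx _) => L; apply/matrixP => i j; rewrite !mxE; ring.
  apply: psdformD; last exact: psdform_gram.
  by apply: psdformD; apply: psdform_conj.
apply: eq_dominated (dominated_map (h := fun a => a / 4) _ four) => [i|i|i j] /=.
- by field.
- by field.
- by rewrite ler_pM2r // invr_gt0.
Qed.

(** With [X = D' D], this rests on [1 - X = (1 - X)^2 + D' (1 - D D') D]. *)
Lemma psdform_contraction D :
  psdform (1%:M - D *m D^t*) -> psdform (1%:M - D^t* *m D).
Proof.
move=> hD; have -> : 1%:M - D^t* *m D =
    (1%:M - D^t* *m D) *m (1%:M - D^t* *m D)^t* + D^t* *m (1%:M - D *m D^t*) *m D^t*^t*.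
  rewrite trmxCK adjmxB adjmxM trmxCK adjmx1.
  rewrite !(mulmxDl, mulmxDr, mulmxN, mulNmx, opprK) !mulmx1 !mul1mx !mulmxA.
  move: (D^t* *m D) (_ *m D^t* *m D) => X Y.
  by apply/matrixP => i j; rewrite !mxE; ring.
by apply: psdformD; [apply: psdform_gram | apply: psdform_conj].
Qed.

(** The key point, stated for factors so that it can be iterated: the pair [D], [E] carries both
    Gram matrices [P = D D'] and [Q = E' E], and the diagonal product [E D] carries the singular
    values. The new pair is [D G] and [H' E] up to unitary factors, where [G G' = 2 - D' D] and
    [H H' = 2 - E E']. *)
Lemma doubling_step D E s : (forall i, 0 <= s i) ->
    psdform (1%:M - D *m D^t*) -> psdform (1%:M - E^t* *m E) ->
    E *m D = dgmx s ->
  exists D' E' s', [/\ forall i, 0 <= s' i,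
    D' *m D'^t* = D *m D^t* *+ 2 - D *m D^t* *m (D *m D^t*),
    E'^t* *m E' = E^t* *m E *+ 2 - E^t* *m E *m (E^t* *m E),
    E' *m D' = dgmx s' & dominated s' (fun i => s i * (2 - s i))].
Proof.
move=> s0 hD hE ED.
have psd2 (X : 'M[C]_n) : psdform (1%:M - X) -> psdform (1%:M *+ 2 - X).
  by move=> hX; rewrite mulr2n -addrA; apply: psdformD hX; apply: psdform1.
have [||G GE] := @psdform_factor _ _ (1%:M *+ 2 - D^t* *m D).
- by rewrite adjmxB adjmxM trmxCK mulr2n adjmxD adjmx1.
- by apply/psd2/psdform_contraction.
have [||H HE] := @psdform_factor _ _ (1%:M *+ 2 - E *m E^t*).
- by rewrite adjmxB adjmxM trmxCK mulr2n adjmxD adjmx1.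
- by apply: psd2; have := @psdform_contraction (E^t*); rewrite trmxCK; apply.
(* The unitary factors [V] and [W] are absorbed into the new pair: its product becomes diagonal
   again, and they cancel in the two Gram matrices. *)
have [V [W [s' [Vu Wu s'0 NE]]]] := svd (H^t* *m dgmx s *m G).
have s'E : dgmx s' = V^t* *m H^t* *m dgmx s *m (G *m W^t*).
  rewrite !mulmxA -[V^t* *m _ *m _]mulmxA -[V^t* *m _ *m G]mulmxA NE !mulmxA.
  by rewrite mulmxtVK // unitarymx_tmul // mul1mx.
exists (D *m G *m W^t*), (V^t* *m H^t* *m E), s'; split => //.
- rewrite (adjmxM (D *m G)) (adjmxM D) (trmxCK W).
  rewrite !mulmxA (mulmxKtV _ Wu) // -[D *m G *m _]mulmxA -GE.
  by rewrite mulmxBr mulmxBl !mulr2n mulmxDr mulmx1 mulmxDl !mulmxA.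
- rewrite (adjmxM (V^t* *m H^t*)) (adjmxM (V^t*)) (trmxCK V) (trmxCK H).
  rewrite !mulmxA (mulmxtVK _ Vu) -[_ *m H *m _]mulmxA -HE.
  by rewrite mulmxBr mulmxBl !mulr2n mulmxDr mulmx1 mulmxDl !mulmxA.
- by rewrite s'E -ED !mulmxA.
have HH : (V^t* *m H^t*)^t* *m (V^t* *m H^t*) = H *m H^t*.
  by rewrite (adjmxM (V^t*)) (trmxCK V) (trmxCK H) mulmxA (mulmxtVK _ Vu).
have GG : (G *m W^t*) *m (G *m W^t*)^t* = G *m G^t*.
  by rewrite (adjmxM G) (trmxCK W) mulmxA (mulmxKtV _ Wu).
(* The weight [4 - 2 s] yields [s (4 - 2 s) / 2 = s (2 - s)]. It is admissible because
   [D' D + E E' - 2 s = (D' - E) (D' - E)'], which uses [E D = s = D' E']. *)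
have := amgm_dominated (w := fun i => 4 - 2 * s i) s0 s'E.
rewrite HH GG -GE -HE => dom_s'.
apply: eq_dominated (dom_s' _) => [//|i|]; first by field.
have -> : dgmx (fun i => 4 - 2 * s i) -
    (1%:M *+ 2 - E *m E^t* + (1%:M *+ 2 - D^t* *m D)) =
    (D^t* - E) *m (D^t* - E)^t*.
  rewrite adjmxB trmxCK !(mulmxDl, mulmxDr, mulmxN, mulNmx, opprK) ED.
  have -> : D^t* *m E^t* = dgmx s by rewrite -adjmxM ED adj_dgmx.
  have -> : dgmx (fun i => 4 - 2 * s i) =
      1%:M + 1%:M + 1%:M + 1%:M - dgmx s - dgmx s.
    by rewrite -dgmx1 !dgmxD !dgmxB; apply: eq_dgmx => i; ring.
  move: (E *m _) (_ *m D) (dgmx s) => X Y L.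
  by apply/matrixP => i j; rewrite !mxE; ring.
exact: psdform_gram.
Qed.

End Dominance.

(** * Doubling and the passage to the limit *)

Section Exponential.
Variable R : realType.

Lemma bernoulli_expr (y : R) M : 0 <= y <= 1 -> 1 - M%:R * y <= (1 - y) ^+ M.
Proof.
move=> /andP[y0 y1]; elim: M => [|M IHM]; first by rewrite mul0r subr0 expr0.
rewrite exprS -natr1; apply: (le_trans _ (ler_wpM2l _ IHM)); last first.
  by rewrite subr_ge0.
have : 0 <= M%:R * (y * y) by rewrite !mulr_ge0.
by nra.
Qed.

(** With [x = c / M], raise [expR (- x) * (1 - x ^+ 2) <= 1 - x] to the power [M]; Bernoulli bounds
    [(1 - x ^+ 2) ^+ M] below by [1 - c ^+ 2 / M]. *)
Lemma expRN_approx (c : R) M : 0 <= c -> c <= M%:R -> (0 < M)%N ->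
  1 - (1 - c / M%:R) ^+ M <= 1 - expR (- c) + c ^+ 2 / M%:R.
Proof.
move=> c0 cM M0; have M0' : 0 < M%:R :> R by rewrite ltr0n.
pose x := c / M%:R; have x0 : 0 <= x by rewrite divr_ge0 // ltW.
have x1 : x <= 1 by rewrite ler_pdivrMr // mul1r.
have base : expR (- x) * (1 - x ^+ 2) <= 1 - x.
  have -> : 1 - x ^+ 2 = (1 + x) * (1 - x) by ring.
  rewrite mulrA ler_piMl ?subr_ge0 // expRN mulrC ler_pdivrMr ?expR_gt0 //.
  by rewrite mul1r expR_ge1Dx.
have x2 : 0 <= x ^+ 2 <= 1 by rewrite sqr_ge0 expr_le1.
have := @bernoulli_expr (x ^+ 2) M x2.
have : expR (- c) * (1 - x ^+ 2) ^+ M <= (1 - x) ^+ M.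
  have -> : expR (- c) = expR (- x) ^+ M.
    by rewrite -expRM_natl mulrN mulrC /x divfK // gt_eqF.
  rewrite -exprMn lerXn2r ?nnegrE ?subr_ge0 // mulr_ge0 ?expR_ge0 //.
  by rewrite subr_ge0; case/andP: x2.
have -> : M%:R * x ^+ 2 = c ^+ 2 / M%:R by rewrite /x; field; rewrite gt_eqF.
rewrite -/x; set e := expR (- c) => h1 h2.
have e1 : e <= 1 by rewrite /e -[leRHS]expR0 ler_expR oppr_le0.
have e0 : 0 <= e by apply: expR_ge0.
have h3 : e * (1 - c ^+ 2 / M%:R) <= e * (1 - x ^+ 2) ^+ M by apply: ler_wpM2l.
have h4 : e * (c ^+ 2 / M%:R) <= c ^+ 2 / M%:R.
  by rewrite ler_piMl // divr_ge0 ?sqr_ge0 // ltW.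
by move: h1 h3 h4; rewrite mulrBr mulr1; lra.
Qed.

Lemma expRN_bounds (x : R) : 0 <= x -> 0 <= 1 - expR (- x) <= x.
Proof.
move=> x0; rewrite subr_ge0 -[leRHS in _ <= leRHS]expR0 ler_expR oppr_le0 x0 /=.
by rewrite lerBlDr -lerBlDl; apply: le_trans (expR_ge1Dx _).
Qed.

(** The limit is replaced by an explicit error [K / 2 ^ m], which is smaller than any assumed gap
    [g] once [m] is large. *)
Lemma le_sum_limit (I : finType) (c : I -> R) (L : R) :
    (forall i, 0 <= c i) ->
    (forall m, (forall i, c i <= (2 ^ m)%:R) ->
      L <= \sum_i (1 - (1 - c i / (2 ^ m)%:R) ^+ (2 ^ m)) ^+ 2) ->
  L <= \sum_i (1 - expR (- c i)) ^+ 2.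
Proof.
move=> c0 hL; rewrite leNgt; apply/negP => ltL.
pose K := \sum_i (2 * c i ^+ 2 + c i ^+ 4).
pose g := L - \sum_i (1 - expR (- c i)) ^+ 2.
have g0 : 0 < g by rewrite subr_gt0.
(* The constant [K] comes from [(u + d)^2 <= u^2 + 2 d + d^2] with [u = 1 - expR (- c i) <= 1] and
   [d = c i ^+ 2 / 2 ^ m], where [d^2 <= c i ^+ 4 / 2 ^ m]. *)
have K0 : 0 <= K.
  by apply: sumr_ge0 => i _; rewrite addr_ge0 ?mulr_ge0 ?exprn_ge0.
(* The first bound makes [2 ^ m] exceed [K / g], the second makes it exceed every [c i]. *)
pose m := maxn (Num.bound (K / g)) (Num.bound (\sum_i c i)).
have ltm (x : R) : 0 <= x -> (Num.bound x <= m)%N -> x < (2 ^ m)%:R.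
  move=> x0 le_m; apply: (lt_le_trans (archi_boundP x0)).
  by rewrite ler_nat (leq_trans le_m) // ltnW // ltn_expl.
have c_le i : c i <= (2 ^ m)%:R.
  apply: le_trans (ltW (ltm (\sum_i c i) _ _)).
  - by rewrite (bigD1 i) //= lerDl sumr_ge0.
  - exact: sumr_ge0.
  - exact: leq_maxr.
have M0 : 0 < (2 ^ m)%:R :> R by rewrite ltr0n expn_gt0.
have M1 : 1 <= (2 ^ m)%:R :> R by rewrite ler1n expn_gt0.
have : L <= \sum_i ((1 - expR (- c i)) ^+ 2 +
                    (2 * c i ^+ 2 + c i ^+ 4) / (2 ^ m)%:R).
  apply: le_trans (hL m c_le) _; apply: ler_sum => i _.
  have := expRN_approx (c0 i) (c_le i) _; rewrite expn_gt0 => /(_ isT).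
  have v0 : 0 <= 1 - (1 - c i / (2 ^ m)%:R) ^+ (2 ^ m).
    rewrite subr_ge0 exprn_ile1 // ?subr_ge0 ?ler_pdivrMr ?mul1r //.
    by rewrite gerBl divr_ge0 // ltW.
  have e1 : expR (- c i) <= 1 by rewrite -[leRHS]expR0 ler_expR oppr_le0.
  have e0 := expR_ge0 (- c i).
  set v := 1 - _ ^+ (2 ^ m) in v0 *; set d := _ / _ => vd.
  have d0 : 0 <= d by rewrite divr_ge0 ?sqr_ge0 // ltW.
  have dd : d ^+ 2 <= c i ^+ 4 / (2 ^ m)%:R.
    rewrite /d expr_div_n -exprM ler_wpM2l ?exprn_ge0 //.
    rewrite lef_pV2 ?posrE ?exprn_gt0 //.
    by rewrite expr2 ler_peMr // ltW.
  have -> : (2 * c i ^+ 2 + c i ^+ 4) / (2 ^ m)%:R =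
            2 * d + c i ^+ 4 / (2 ^ m)%:R by rewrite /d; ring.
  apply: (@le_trans _ _ ((1 - expR (- c i) + d) ^+ 2)).
    by rewrite lerXn2r ?nnegrE // addr_ge0 // subr_ge0.
  have : expR (- c i) * d >= 0 by rewrite mulr_ge0.
  by move: dd; nra.
rewrite big_split /= -mulr_suml -/K => leL.
have : g <= K / (2 ^ m)%:R by rewrite /g lerBlDl.
rewrite leNgt ltr_pdivrMr // mulrC -ltr_pdivrMr // ltm ?leq_maxl //.
by rewrite divr_ge0 // ltW.
Qed.

(** * Functional calculus and pairs of factors with diagonal product *)

Variable n : nat.
Local Notation C := R[i].
Implicit Types (U V W D E F G : 'M[C]_n) (a b c p q s : 'I_n -> R).

(** The functional calculus does not depend on the chosen diagonalisation. The change of basis [T]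
    intertwines [d] and [a], so [T i j] can be nonzero only where the eigenvalues [d i] and [a j]
    agree, and [T] intertwines their images under [f] as well. *)
Lemma mxfun_unitary f U a : U \is unitarymx ->
  mxfun f (U^t* *m dgmx a *m U) = U^t* *m dgmx (f \o a) *m U.
Proof.
move=> Uu; set A := U^t* *m dgmx a *m U.
have AH : A \is hermsymmx.
  apply/is_hermitianmxP; rewrite expr0 scale1r /A.
  by rewrite (adjmxM (U^t* *m _)) (adjmxM (U^t*)) adj_dgmx (trmxCK U) mulmxA.
have Su := spectral_unitarymx A.
have AS := orthomx_spectralP (hermitian_normalmx AH).
rewrite /mxfun; move: AS Su; move: (spectralmx A) (spectral_diag A) => S d.
move=> AS Su; rewrite (invmx_unitary Su) in AS *.
pose T := S *m U^t*.
have dT : diag_mx d *m T = T *m dgmx a.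
  have -> : T *m dgmx a = S *m A *m U^t*.
    by rewrite /A /T !mulmxA (mulmxtVK _ Uu).
  by rewrite AS /T !mulmxA (unitarymxP Su) mul1mx.
have fdT : diag_mx (map_mx (fun z : C => (f (complex.Re z))%:C%C) d) *m T =
    T *m dgmx (f \o a).
  move: T dT => T /matrixP dT; apply/matrixP => i j; have := dT i j.
  rewrite !mul_diag_mx /dgmx !mul_mx_diag !mxE.
  have [->|Tij] := eqVneq (T i j) 0; first by rewrite !mulr0 !mul0r.
  by rewrite mulrC => /(mulfI Tij) ->; rewrite mulrC.
have SE : S = T *m U by rewrite /T (mulmxKtV _ Uu).
rewrite [X in _ *m X]SE mulmxA -[_ *m _ *m T]mulmxA fdT /T !mulmxA.
by rewrite (unitarymx_tmul Su) mul1mx.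
Qed.

Lemma unitary_conj_dgmx_sub1 U a : U \is unitarymx ->
  1%:M - U^t* *m dgmx a *m U = U^t* *m dgmx (fun i => 1 - a i) *m U.
Proof.
by move=> Uu; rewrite -dgmxB dgmx1 mulmxBr mulmxBl mulmx1 (unitarymx_tmul Uu).
Qed.

Lemma unitary_conj_dgmx_mul U a b : U \is unitarymx ->
  U^t* *m dgmx a *m U *m (U^t* *m dgmx b *m U) =
  U^t* *m dgmx (fun i => a i * b i) *m U.
Proof.
by move=> Uu; rewrite -dgmxM !mulmxA (mulmxtVK _ Uu).
Qed.

(** Multiplying by diagonal matrices of norm at most the square root of [e] on either side scales
    singular values by at most [e]; this is the mean inequality with constant weight [2 * e]. *)
Lemma scaled_factor_dominated F G V W c x y (e : R) :
    V \is unitarymx -> W \is unitarymx -> (forall i, 0 <= c i) ->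
    (forall i, x i * x i <= e) -> (forall i, y i * y i <= e) ->
    G *m F = V *m dgmx c *m W ->
  exists D E s, [/\ forall i, 0 <= s i,
    D *m D^t* = F *m dgmx (fun i => x i * x i) *m F^t*,
    E^t* *m E = G^t* *m dgmx (fun i => y i * y i) *m G,
    E *m D = dgmx s & dominated s (fun i => e * c i)].
Proof.
move=> Vu Wu c0 xe ye GF.
have [V1 [W1 [s [V1u W1u s0 NE]]]] := svd (dgmx y *m (G *m F) *m dgmx x).
have VEW (X : 'M[C]_n) : V1^t* *m (V1 *m X *m W1) *m W1^t* = X.
  by rewrite !mulmxA (mulmxtVK _ W1u) (unitarymx_tmul V1u) mul1mx.
have ED : V1^t* *m dgmx y *m G *m (F *m dgmx x *m W1^t*) = dgmx s.
  by rewrite -[RHS]VEW -NE !mulmxA.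
have sE : dgmx s = V1^t* *m dgmx y *m V *m dgmx c *m (W *m dgmx x *m W1^t*).
  by rewrite -[LHS]VEW -NE GF !mulmxA.
exists (F *m dgmx x *m W1^t*), (V1^t* *m dgmx y *m G), s; split.
- exact: s0.
- rewrite (adjmxM (F *m _)) (adjmxM F) (trmxCK W1) adj_dgmx.
  rewrite !mulmxA (mulmxKtV _ W1u erefl).
  by rewrite -[F *m _ *m dgmx x]mulmxA dgmxM.
- rewrite (adjmxM (V1^t* *m _)) (adjmxM (V1^t*)) (trmxCK V1) adj_dgmx.
  rewrite !mulmxA (mulmxtVK _ V1u).
  by rewrite -[G^t* *m _ *m dgmx y]mulmxA dgmxM.
- exact: ED.
apply: eq_dominated (amgm_dominated (w := fun=> 2 * e) c0 sE _) => [//|i|].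
  by field.
have HH : (V1^t* *m dgmx y *m V)^t* *m (V1^t* *m dgmx y *m V) =
    V^t* *m dgmx (fun i => y i * y i) *m (V^t*)^t*.
  rewrite (adjmxM (V1^t* *m _)) (adjmxM (V1^t*)) (trmxCK V1) (trmxCK V) adj_dgmx.
  by rewrite !mulmxA (mulmxtVK _ V1u) -[V^t* *m _ *m dgmx y]mulmxA dgmxM.
have GG : W *m dgmx x *m W1^t* *m (W *m dgmx x *m W1^t*)^t* =
    W *m dgmx (fun i => x i * x i) *m W^t*.
  rewrite (adjmxM (W *m _)) (adjmxM W) (trmxCK W1) adj_dgmx.
  by rewrite !mulmxA (mulmxKtV _ W1u erefl) -[W *m _ *m dgmx x]mulmxA dgmxM.
have psdB U x' : U \is unitarymx -> (forall i, x' i <= e) ->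
    psdform (dgmx (fun=> e) - U *m dgmx x' *m U^t*).
  move=> Uu x'e; have -> : dgmx (fun=> e) = U *m dgmx (fun=> e) *m U^t*.
    have -> : dgmx (fun=> e : R) = e%:C%C%:M :> 'M[C]_n.
      by apply/matrixP => i j; rewrite dgmxE !mxE.
    by rewrite mul_mx_scalar -scalemxAl (unitarymxP Uu) scalemx1.
  rewrite -mulmxBl -mulmxBr dgmxB; apply: psdform_conj; apply: psdform_dgmx => i.
  by rewrite subr_ge0.
have Vu' : V^t* \is unitarymx by rewrite trmxC_unitary; exact: Vu.
have -> : dgmx (fun=> 2 * e) =
    dgmx (fun _ : 'I_n => e) + dgmx (fun _ : 'I_n => e).
  by rewrite dgmxD; apply: eq_dgmx => i; ring.
rewrite HH GG opprD addrACA; apply: psdformD; first exact: psdB.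
exact: psdB.
Qed.

(** Base of the iteration: matrices below [e A] and [e B], diagonal in the same eigenbases as [A]
    and [B], are reached from the square roots of [A] and [B] by diagonal scalings. *)
Lemma factor_le_scaled U1 U2 V W a b c p q (e : R) :
    V \is unitarymx -> W \is unitarymx ->
    (forall i, 0 <= a i) -> (forall i, 0 <= b i) -> (forall i, 0 <= c i) ->
    (forall i, 0 <= p i <= e * a i) -> (forall i, 0 <= q i <= e * b i) -> 0 <= e ->
    dgmx (Num.sqrt \o b) *m U2 *m (U1^t* *m dgmx (Num.sqrt \o a)) =
      V *m dgmx c *m W ->
  exists D E s, [/\ forall i, 0 <= s i, D *m D^t* = U1^t* *m dgmx p *m U1,
    E^t* *m E = U2^t* *m dgmx q *m U2, E *m D = dgmx s &
    dominated s (fun i => e * c i)].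
Proof.
move=> Vu Wu a0 b0 c0 pa qb e0.
(* Where [x i = 0] the quotient is zero by convention, and [y i <= e * x i] forces [y i = 0], so the
   rescaling is still exact. *)
pose z (x y : 'I_n -> R) i := Num.sqrt (y i / x i).
have zz (x y : 'I_n -> R) i : 0 <= x i -> 0 <= y i <= e * x i ->
    z x y i * z x y i = y i / x i.
  by move=> x0 /andP[y0 yx]; rewrite -expr2 sqr_sqrtr // divr_ge0.
have ze x y i : 0 <= x i -> 0 <= y i <= e * x i -> z x y i * z x y i <= e.
  move=> x0 yx; rewrite zz //; case/andP: yx => y0 yx.
  have [xi|xi] := eqVneq (x i) 0; first by rewrite xi invr0 mulr0.
  by rewrite ler_pdivrMr ?lt_def ?xi.
have zx x y : (forall i, 0 <= x i) -> (forall i, 0 <= y i <= e * x i) ->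
    dgmx (Num.sqrt \o x) *m dgmx (fun i => z x y i * z x y i) *m
    dgmx (Num.sqrt \o x) = dgmx y.
  move=> x0 yx; rewrite !dgmxM; apply: eq_dgmx => i /=.
  rewrite zz // mulrAC -expr2 sqr_sqrtr //.
  have [xi|xi] := eqVneq (x i) 0; last by rewrite mulrC divfK.
  have := yx i; rewrite xi mul0r mulr0 => /andP[y0 yle].
  by apply/le_anti/andP.
move=> TE; have [D [E [s [s0 DE EE ED dom_s]]]] :=
  scaled_factor_dominated Vu Wu c0
  (fun i => ze _ _ _ (a0 i) (pa i)) (fun i => ze _ _ _ (b0 i) (qb i)) TE.
exists D, E, s; split.
- exact: s0.
- rewrite DE (adjmxM (U1^t*)) adj_dgmx (trmxCK U1) -(zx _ _ a0 pa).
  by rewrite !mulmxA.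
- rewrite EE (adjmxM (dgmx _)) adj_dgmx -(zx _ _ b0 qb).
  by rewrite !mulmxA.
- exact: ED.
- exact: dom_s.
Qed.

(** The scale [e] stays fixed during the induction on [m], and only later becomes [1 / 2 ^ m]. Each
    doubling replaces [1 - u] by [1 - u ^+ 2], both for [u = expR (- x)] and in the dominating
    family. *)
Lemma expR_factor_dominated U1 U2 V W a b c (e : R) m :
    U1 \is unitarymx -> U2 \is unitarymx -> V \is unitarymx -> W \is unitarymx ->
    (forall i, 0 <= a i) -> (forall i, 0 <= b i) -> (forall i, 0 <= c i) ->
    0 <= e -> (forall i, e * c i <= 1) ->
    dgmx (Num.sqrt \o b) *m U2 *m (U1^t* *m dgmx (Num.sqrt \o a)) =
      V *m dgmx c *m W ->
  exists D E s, [/\ forall i, 0 <= s i,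
    D *m D^t* = U1^t* *m dgmx (fun i => 1 - expR (- (e * (2 ^ m)%:R * a i))) *m U1,
    E^t* *m E = U2^t* *m dgmx (fun i => 1 - expR (- (e * (2 ^ m)%:R * b i))) *m U2,
    E *m D = dgmx s &
    dominated s (fun i => 1 - (1 - e * c i) ^+ (2 ^ m))].
Proof.
move=> U1u U2u Vu Wu a0 b0 c0 e0 ec TE.
elim: m => [|m [D [E [s [s0 DE EE ED dom_s]]]]].
  have bnd (x : 'I_n -> R) i : 0 <= x i ->
      0 <= 1 - expR (- (e * (2 ^ 0)%:R * x i)) <= e * x i.
    by move=> x0; rewrite expn0 mulr1 expRN_bounds ?mulr_ge0.
  have [D [E [s [s0 DE EE ED dom_s]]]] := factor_le_scaled Vu Wu a0 b0 c0
    (fun i => bnd a i (a0 i)) (fun i => bnd b i (b0 i)) e0 TE.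
  exists D, E, s; split => //; apply: eq_dominated dom_s => // i.
  by rewrite expn0 expr1 opprB addrC subrK.
have psd1 U x : U \is unitarymx ->
    psdform (1%:M - U^t* *m dgmx (fun i => 1 - expR (x i)) *m U).
  move=> Uu; rewrite (unitary_conj_dgmx_sub1 _ Uu) -[X in _ *m X](trmxCK U).
  apply: psdform_conj; apply: psdform_dgmx => i.
  by rewrite opprB addrC subrK expR_ge0.
have dbl U x : U \is unitarymx ->
    let P := U^t* *m dgmx (fun i => 1 - expR (- (e * (2 ^ m)%:R * x i))) *m U in
    P *+ 2 - P *m P =
    U^t* *m dgmx (fun i => 1 - expR (- (e * (2 ^ m.+1)%:R * x i))) *m U.
  move=> Uu /=; rewrite (unitary_conj_dgmx_mul _ _ Uu) mulr2n.
  rewrite -mulmxDl -mulmxDr -mulmxBl -mulmxBr dgmxD dgmxB.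
  congr (_ *m _ *m _); apply: eq_dgmx => i.
  rewrite expnS natrM; set y := e * (2 ^ m)%:R * x i.
  have -> : e * (2%:R * (2 ^ m)%:R) * x i = y + y by rewrite /y; ring.
  by rewrite opprD expRD; ring.
have [|| D' [E' [s' [s'0 D'E E'E ED' dom_s']]]] :=
  @doubling_step _ _ D E s s0 _ _ ED.
- by rewrite DE; apply: psd1.
- by rewrite EE; apply: psd1.
exists D', E', s'; split => //.
- by rewrite D'E DE; apply: dbl.
- by rewrite E'E EE; apply: dbl.
apply: dominated_trans dom_s' _.
apply: eq_dominated (dominated_map (h := fun x => x * (2 - x)) _ dom_s)
  => [//|i|i j] /=.
  by rewrite expnS mulnC exprM; ring.
(* The dominating value is [1 - r] with [r >= 0], hence at most 1, and [x * (2 - x)] is increasing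
   up to 1. *)
have : 0 <= (1 - e * c j) ^+ (2 ^ m) by rewrite exprn_ge0 // subr_ge0.
by move: (_ ^+ (2 ^ m)) (s i) => r x; nra.
Qed.

Lemma mxtrace_factors D E s : E *m D = dgmx s ->
  \tr (D *m D^t* *m (E^t* *m E)) = (\sum_i s i ^+ 2)%:C%C.
Proof.
move=> ED; rewrite -mulmxA mxtrace_mulC !mulmxA -(adjmxM E) ED adj_dgmx.
rewrite -mulmxA ED dgmxM mxtrace_dgmx.
by congr (_ %:C)%C; apply: eq_bigr => i _; rewrite expr2.
Qed.

Lemma mxtrace_unitary_conj U a : U \is unitarymx ->
  \tr (U^t* *m dgmx a *m U) = (\sum_i a i)%:C%C.
Proof.
by move=> Uu; rewrite -mulmxA mxtrace_mulC (mulmxtVK _ Uu) mxtrace_dgmx.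
Qed.

Lemma mexpN_unitary U a : U \is unitarymx ->
  mexp (- (U^t* *m dgmx a *m U)) = U^t* *m dgmx (fun i => expR (- a i)) *m U.
Proof.
move=> Uu; have -> : - (U^t* *m dgmx a *m U) = U^t* *m dgmx (fun i => - a i) *m U.
  have -> : dgmx (fun i => - a i) = - dgmx a.
    by apply/matrixP => i j; rewrite [RHS]mxE !dgmxE rmorphN mulNrn.
  by rewrite mulmxN mulNmx.
exact: mxfun_unitary.
Qed.

Lemma mxtrace_sub_expR_le U1 U2 V W a b c :
    U1 \is unitarymx -> U2 \is unitarymx -> V \is unitarymx -> W \is unitarymx ->
    (forall i, 0 <= a i) -> (forall i, 0 <= b i) -> (forall i, 0 <= c i) ->
    dgmx (Num.sqrt \o b) *m U2 *m (U1^t* *m dgmx (Num.sqrt \o a)) =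
      V *m dgmx c *m W ->
  \tr (U1^t* *m dgmx (fun i => 1 - expR (- a i)) *m U1 *m
       (U2^t* *m dgmx (fun i => 1 - expR (- b i)) *m U2)) <=
    (\sum_i (1 - expR (- c i)) ^+ 2)%:C%C.
Proof.
move=> U1u U2u Vu Wu a0 b0 c0 TE.
have bnd (x : 'I_n -> R) i : 0 <= x i -> 0 <= 1 - expR (- x i) <= 1 * x i.
  by move=> x0; rewrite mul1r expRN_bounds.
(* This pair, at scale 1, serves to write the complex trace as a real sum of squares, so that the
   limit argument applies. *)
have [D [E [s [_ DE EE ED _]]]] := factor_le_scaled Vu Wu a0 b0 c0
  (fun i => bnd a i (a0 i)) (fun i => bnd b i (b0 i)) ler01 TE.
rewrite -DE -EE (mxtrace_factors ED) lecR.
apply: (le_sum_limit c0) => m cm.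
have M0 : 0 < (2 ^ m)%:R :> R by rewrite ltr0n expn_gt0.
have e0 : 0 <= (2 ^ m)%:R^-1 :> R by rewrite invr_ge0 ltW.
have ec i : (2 ^ m)%:R^-1 * c i <= 1 by rewrite mulrC ler_pdivrMr // mul1r.
(* With [e = 1 / 2 ^ m], [m] doublings lead back to the Gram matrices of the first pair; the two
   sums of squares are thus the same trace. *)
have [D' [E' [s' [s'0 D'E E'E ED' dom_s']]]] :=
  expR_factor_dominated m U1u U2u Vu Wu a0 b0 c0 e0 ec TE.
have eq_exp (x : 'I_n -> R) :
    dgmx (fun i => 1 - expR (- ((2 ^ m)%:R^-1 * (2 ^ m)%:R * x i))) =
    dgmx (fun i => 1 - expR (- x i)).
  by apply: eq_dgmx => i; rewrite mulVf ?mul1r // gt_eqF.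
rewrite (eq_exp a) -DE in D'E; rewrite (eq_exp b) -EE in E'E.
have -> : \sum_i s i ^+ 2 = \sum_i s' i ^+ 2.
  apply: (@complexI R).
  by rewrite -(mxtrace_factors ED) -(mxtrace_factors ED') D'E E'E.
apply: dominated_sum => [i|]; first exact: sqr_ge0.
apply: eq_dominated (dominated_map (h := fun x => x ^+ 2) _ dom_s')
  => [//|i|i j] /=.
  by rewrite [_^-1 * _]mulrC.
by move=> le_s; rewrite lerXn2r ?nnegrE // (le_trans _ le_s).
Qed.

(** * The matrix square root and the final trace identity *)

Lemma msqrt_unitary U a : U \is unitarymx ->
  msqrt (U^t* *m dgmx a *m U) = U^t* *m dgmx (Num.sqrt \o a) *m U.
Proof. exact: mxfun_unitary. Qed.

(** With [T] the product decomposed in the hypothesis, the matrix under the outer root is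
    [U1' T' T U1], and [T' T = W' c^2 W]; hence the singular values of [T] are the eigenvalues of
    [C]. *)
Lemma msqrt_sandwich U1 U2 V W a b c :
    U1 \is unitarymx -> U2 \is unitarymx -> V \is unitarymx -> W \is unitarymx ->
    (forall i, 0 <= b i) -> (forall i, 0 <= c i) ->
    dgmx (Num.sqrt \o b) *m U2 *m (U1^t* *m dgmx (Num.sqrt \o a)) =
      V *m dgmx c *m W ->
  let A := U1^t* *m dgmx a *m U1 in
  msqrt (msqrt A *m (U2^t* *m dgmx b *m U2) *m msqrt A) =
    (W *m U1)^t* *m dgmx c *m (W *m U1).
Proof.
move=> U1u U2u Vu Wu b0 c0 TE A; rewrite (msqrt_unitary _ U1u).
have bE : dgmx b = dgmx (Num.sqrt \o b) *m dgmx (Num.sqrt \o b).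
  by rewrite dgmxM; apply: eq_dgmx => i /=; rewrite -expr2 sqr_sqrtr.
move: (dgmx (Num.sqrt \o b)) (dgmx (Num.sqrt \o a)) bE TE
  (adj_dgmx (Num.sqrt \o b)) (adj_dgmx (Num.sqrt \o a)) => b' a' -> TE b'H a'H.
have T'E : a' *m U1 *m U2^t* *m b' = W^t* *m dgmx c *m V^t*.
  apply: (@etrans _ _ ((b' *m U2 *m (U1^t* *m a'))^t*)).
    rewrite (adjmxM (b' *m U2)) (adjmxM b') (adjmxM (U1^t*)) (trmxCK U1).
    by rewrite a'H b'H !mulmxA.
  by rewrite TE (adjmxM (V *m _)) (adjmxM V) adj_dgmx mulmxA.
have -> : U1^t* *m a' *m U1 *m (U2^t* *m (b' *m b') *m U2) *m
    (U1^t* *m a' *m U1) =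
    U1^t* *m (a' *m U1 *m U2^t* *m b') *m (b' *m U2 *m (U1^t* *m a')) *m U1.
  by rewrite !mulmxA.
have -> : U1^t* *m (a' *m U1 *m U2^t* *m b') *m
    (b' *m U2 *m (U1^t* *m a')) *m U1 =
    (W *m U1)^t* *m dgmx (fun i => c i * c i) *m (W *m U1).
  rewrite T'E TE (adjmxM W) -dgmxM !mulmxA.
  by rewrite (mulmxKtV _ Vu erefl).
rewrite (msqrt_unitary _ (mul_unitarymx Wu U1u)); congr (_ *m _ *m _).
by apply: eq_dgmx => i /=; rewrite -expr2 sqrtr_sqr ger0_norm.
Qed.

Lemma mxtrace_mul_sub1 (X Y : 'M[C]_n) :
  \tr ((1%:M - X) *m (1%:M - Y)) = n%:R - (\tr X + \tr Y) + \tr (X *m Y).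
Proof.
rewrite mulmxBl mul1mx mulmxBr mulmx1 !raddfB /= mxtrace1.
by ring.
Qed.

End Exponential.

Unset Implicit Arguments.
Set Strict Implicit.

Theorem theorem3 (R : realType) (n : nat) (A B : 'M[R[i]]_n) :
  psdmx A -> psdmx B ->
  let C := msqrt (msqrt A *m B *m msqrt A) in
  \tr (mexp (- A) *m mexp (- B))
    <= \tr (mexp (- A) + mexp (- B)) + \tr (mexp (- (C *+ 2)) - mexp (- C) *+ 2).
Proof.
have diagonalize (X : 'M[R[i]]_n) : psdmx X ->
    exists (U : 'M[R[i]]_n) (x : 'I_n -> R),
      [/\ U \is unitarymx, forall i, 0 <= x i & X = U^t* *m dgmx x *m U].
  move=> [/is_hermitianmxP XH pX]; apply: psdform_spectral pX.
  by rewrite [RHS]XH expr0 scale1r.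
move=> psdA psdB; cbv zeta; set C := msqrt (msqrt A *m B *m msqrt A).
have [U1 [a [U1u a0 AE]]] := diagonalize A psdA.
have [U2 [b [U2u b0 BE]]] := diagonalize B psdB.
have [V [W [c [Vu Wu c0 TE]]]] :=
  svd (dgmx (Num.sqrt \o b) *m U2 *m (U1^t* *m dgmx (Num.sqrt \o a))).
have Zu := mul_unitarymx Wu U1u; set Z := W *m U1 in Zu.
have CE : C = Z^t* *m dgmx c *m Z.
  by rewrite /C AE BE; apply: msqrt_sandwich U1u U2u Vu Wu b0 c0 TE.
have C2E : C *+ 2 = Z^t* *m dgmx (fun i => c i + c i) *m Z.
  by rewrite mulr2n CE -dgmxD mulmxDr mulmxDl.
have := mxtrace_sub_expR_le U1u U2u Vu Wu a0 b0 c0 TE.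
rewrite -(unitary_conj_dgmx_sub1 _ U1u) -(unitary_conj_dgmx_sub1 _ U2u).
rewrite -(mexpN_unitary _ U1u) -(mexpN_unitary _ U2u) -AE -BE mxtrace_mul_sub1.
(* Expand [(1 - u)^2 = 1 + u^2 - 2 u] at [u = expR (- c i)] in the common eigenbasis of [C] and
   [C *+ 2]; the ones add up to [n], which cancels against the [n] from the left-hand trace. *)
have -> : (\sum_i (1 - expR (- c i)) ^+ 2)%:C%C =
    n%:R + \tr (mexp (- (C *+ 2)) - mexp (- C) *+ 2).
  rewrite C2E CE !(mexpN_unitary _ Zu) raddfB /= raddfMn /=.
  rewrite !(mxtrace_unitary_conj _ Zu) -[n%:R](rmorph_nat (real_complex R)).
  rewrite -rmorphMn -rmorphB -rmorphD; congr (_ %:C)%C.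
  rewrite -sumrMnl -sumrB -[n%:R](_ : \sum_(i < n) 1 = _); last first.
    by rewrite sumr_const card_ord.
  by rewrite -big_split; apply: eq_bigr => i _ /=; rewrite opprD expRD; ring.
rewrite -addrA lerD2l addrC lerBlDr addrC -mxtraceD.
exact: id.
Qed.
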